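(* Let $D\subset\mathbb{R}^d$ be a finite set, let $\epsilon>0$, and let $\tilde{\kappa}(x,y)=\exp(-\|x-y\|^2/\epsilon^2)$. Let $K\ge 2$ be an integer with $K\le |D|$. Let $S_{opt}\subseteq D$ with $|S_{opt}|=K$ minimize $\sum_{s_i,s_j\in S,\ i<j}\tilde{\kappa}(s_i,s_j)$ over all $K$-subsets $S\subseteq D$. Let $S_{int}\subseteq D$ with $|S_{int}|=K$ be a sample produced by the Interchange algorithm run until no replacement decreases the objective. This means: for every $s\in S_{int}$ and every $t\in D\setminus S_{int}$, the objective of $(S_{int}\setminus\{s\})\cup\{t\}$ is not smaller than that of $S_{int}$. Then $$\frac{1}{K(K-1)}\sum_{s_i,s_j\in S_{int},\ i<j}\tilde{\kappa}(s_i,s_j)\ \le\ \frac14+\frac{1}{K(K-1)}\sum_{s_i,s_j\in S_{opt},\ i<j}\tilde{\kappa}(s_i,s_j).$$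
   Context: The Interchange algorithm starts from a $K$-subset of $D$. It repeatedly replaces one element of the current subset by an element of $D$ outside it whenever this strictly decreases the objective $\sum_{s_i,s_j\in S,\ i<j}\tilde{\kappa}(s_i,s_j)$. *)

(* Defs.v *)
From HB Require Import structures.
From mathcomp Require Import all_boot all_order all_algebra.
From mathcomp Require Import finmap.
From mathcomp Require Import all_classical all_reals all_analysis.
Set Implicit Arguments. Unset Strict Implicit. Unset Printing Implicit Defensive.
Import Order.TTheory GRing.Theory Num.Theory.
Local Open Scope ring_scope.
Local Open Scope fset_scope.

Definition sqdist (R : realType) (d : nat) (x y : 'rV[R]_d) : R :=
  \sum_(i < d) (x ord0 i - y ord0 i) ^+ 2.

Definition gkernel (R : realType) (d : nat) (eps : R) (x y : 'rV[R]_d) : R :=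
  expR (- (sqdist x y / eps ^+ 2)).

(* Objective: sum over unordered pairs {s_i, s_j} (i < j) of distinct points
   of S, computed as half the sum over ordered pairs of distinct points. *)
Definition objective (R : realType) (d : nat) (eps : R)
    (S : {fset 'rV[R]_d}) : R :=
  (\sum_(x <- S) \sum_(y <- S | x != y) gkernel eps x y) / 2.

(* Main.v *)
(* Write A for the stable sample, B for the optimal one, C for their
   intersection, A' = A \ B, B' = B \ A, m = |A'| = |B'|, and k(S, T) for the
   sum of the kernel over S x T.  Summing the stability inequalities over
   A' x B' gives m k(A', A) + k(A', B') <= m^2 + m k(B', A), and positive
   definiteness of the Gaussian kernel gives 2 k(A', B') <= k(A', A') + k(B', B').
   With k(A', A'), k(B', B') >= m these bound the gap between the objectives by
   m - 1, which is at most K(K-1)/4 unless m = K <= 3.  For m = K = 3 the same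
   inequalities, without the terms in C, still suffice.  For K = 2 they do not,
   and the bound |x - y|^2 <= 2|z - x|^2 + 2|z - y|^2 is used instead. *)
Require Import Defs.
From HB Require Import structures.
From mathcomp Require Import all_boot all_order all_algebra.
From mathcomp Require Import finmap.
From mathcomp Require Import all_classical all_reals all_analysis.
From mathcomp Require Import ring lra zify.
Import Order.TTheory GRing.Theory Num.Theory.
Import numFieldNormedType.Exports.
Local Open Scope fset_scope.
Local Open Scope ring_scope.

(** * Positive semidefinite kernels and their closure properties *)

(** The index type is arbitrary, so the same point may occur under two indices carrying different
    coefficients. *)
Definition psd {R : realType} {I : Type} (k : I -> I -> R) : Prop :=
  forall (s : seq I) (c : I -> R),
    0 <= \sum_(i <- s) \sum_(j <- s) c i * c j * k i j.

Lemma psd_ext (R : realType) (I : Type) (k l : I -> I -> R) :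
  (forall i j, k i j = l i j) -> psd k -> psd l.
Proof.
move=> kl pk s c; rewrite (le_trans (pk s c))// le_eqVlt; apply/orP; left.
by apply/eqP/eq_bigr => i _; apply: eq_bigr => j _; rewrite kl.
Qed.

Lemma psd_weight (R : realType) (I : Type) (g : I -> R) (k : I -> I -> R) :
  psd k -> psd (fun i j => g i * g j * k i j).
Proof.
move=> pk s c; rewrite (le_trans (pk s (fun i => c i * g i)))//.
by rewrite le_eqVlt; apply/orP; left; apply/eqP/eq_bigr => i _;
  apply: eq_bigr => j _; ring.
Qed.

Lemma psd_sum (R : realType) (I J : Type) (r : seq J) (k : J -> I -> I -> R) :
  (forall l, psd (k l)) -> psd (fun i j => \sum_(l <- r) k l i j).
Proof.
move=> pk s c; under eq_bigr do under eq_bigr do rewrite mulr_sumr.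
under eq_bigr do rewrite exchange_big.
by rewrite exchange_big; apply: sumr_ge0 => l _; exact: pk.
Qed.

Lemma psd_scale (R : realType) (I : Type) (a : R) (k : I -> I -> R) :
  0 <= a -> psd k -> psd (fun i j => a * k i j).
Proof.
move=> a0 pk s c; under eq_bigr do under eq_bigr do rewrite mulrCA.
by under eq_bigr do rewrite -mulr_sumr; rewrite -mulr_sumr mulr_ge0// pk.
Qed.

Lemma psd_lim (R : realType) (I : Type) (k : nat -> I -> I -> R)
    (l : I -> I -> R) :
  (forall n, psd (k n)) ->
  (forall i j, k n i j @[n --> \oo] --> l i j)%classic -> psd l.
Proof.
move=> pk kl s c.
have cv : ((fun n => \sum_(i <- s) \sum_(j <- s) c i * c j * k n i j) x
    @[x --> \oo] --> \sum_(i <- s) \sum_(j <- s) c i * c j * l i j)%classic.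
  apply: cvg_big => [|i _]; first exact: add_continuous.
  apply: cvg_big => [|j _]; first exact: add_continuous.
  by apply: cvgM; [exact: cvg_cst | exact: kl].
rewrite -(cvg_lim _ cv)//; apply: limr_ge; first by apply/cvg_ex; eexists; exact: cv.
by apply: nearW => n; exact: pk.
Qed.

(** * Positive semidefiniteness and bounds for the Gaussian kernel *)

Definition dot {R : realType} {d : nat} (x y : 'rV[R]_d) : R :=
  \sum_(l < d) x ord0 l * y ord0 l.

(** One factor of the power is expanded over coordinates: each coordinate contributes a rank-one
    weighting of the previous power, so [psd_weight] and [psd_sum] replace the Schur product
    theorem. *)
Lemma psd_dotX (R : realType) (d : nat) (I : Type) (f : I -> 'rV[R]_d) n :
  psd (fun i j => dot (f i) (f j) ^+ n).
Proof.
elim: n => [|n IHn].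
  move=> s c; rewrite (_ : (\sum_(i <- s) _) = (\sum_(i <- s) c i) ^+ 2) ?sqr_ge0//.
  rewrite expr2 mulr_suml; apply: eq_bigr => i _; rewrite mulr_sumr.
  by apply: eq_bigr => j _; rewrite expr0 mulr1.
apply: (@psd_ext _ _ (fun i j => \sum_(l < d)
    f i ord0 l * f j ord0 l * dot (f i) (f j) ^+ n)) => [i j|].
  by rewrite exprS -mulr_suml.
apply: psd_sum => l.
exact: (@psd_weight _ _ (fun i => f i ord0 l)
  (fun i j => dot (f i) (f j) ^+ n)).
Qed.

(** The partial sums of the exponential series are nonnegative combinations of powers of [dot], and
    [psd] passes to the limit. *)
Lemma psd_expR_dot (R : realType) (d : nat) (I : Type) (f : I -> 'rV[R]_d)
    (a : R) : 0 <= a -> psd (fun i j => expR (a * dot (f i) (f j))).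
Proof.
move=> a0.
apply: (@psd_lim _ _ (fun n i j =>
  series (exp_coeff (a * dot (f i) (f j))) n)) => [n|i j]; last first.
  exact: is_cvg_series_exp_coeff.
apply: psd_sum => l.
apply: (@psd_ext _ _ (fun i j => l`!%:R^-1 * a ^+ l * dot (f i) (f j) ^+ l)).
  by move=> i j; rewrite exp_coeffE exprMn mulrA.
by apply: psd_scale (psd_dotX _ _ _ _ _); rewrite mulr_ge0 ?exprn_ge0 ?invr_ge0.
Qed.

Lemma sqdistE (R : realType) (d : nat) (x y : 'rV[R]_d) :
  sqdist x y = dot x x + dot y y - 2 * dot x y.
Proof.
by rewrite /sqdist /dot mulr_sumr -big_split -sumrB; apply: eq_bigr => l _ /=; ring.
Qed.

Lemma sqdistC (R : realType) (d : nat) (x y : 'rV[R]_d) :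
  sqdist x y = sqdist y x.
Proof. by apply: eq_bigr => l _; ring. Qed.

(** By the parallelogram law, the slack is |x + y - 2z|^2. *)
Lemma sqdist_le (R : realType) (d : nat) (x y z : 'rV[R]_d) :
  sqdist x y <= 2 * sqdist z x + 2 * sqdist z y.
Proof.
rewrite /sqdist !mulr_sumr -big_split; apply: ler_sum => l _ /=.
by rewrite -subr_ge0 (_ : _ - _ = (x ord0 l + y ord0 l - 2 * z ord0 l) ^+ 2)
  ?sqr_ge0//; ring.
Qed.

(** Expanding |x - y|^2 splits the kernel into an exponential of the inner product and a weight [g]
    in each variable. *)
Lemma psd_gkernel (R : realType) (d : nat) (I : Type) (f : I -> 'rV[R]_d)
    (eps : R) : psd (fun i j => gkernel eps (f i) (f j)).
Proof.
pose g i := expR (- (dot (f i) (f i) / eps ^+ 2)).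
apply: (@psd_ext _ _ (fun i j =>
  g i * g j * expR (2 / eps ^+ 2 * dot (f i) (f j)))).
  by move=> i j; rewrite /g /gkernel -!expRD sqdistE; congr expR; ring.
by apply/psd_weight/psd_expR_dot; rewrite divr_ge0 ?sqr_ge0.
Qed.

Lemma gkernel_ge0 (R : realType) (d : nat) (eps : R) (x y : 'rV[R]_d) :
  0 <= gkernel eps x y.
Proof. exact: expR_ge0. Qed.

Lemma gkernelxx (R : realType) (d : nat) (eps : R) (x : 'rV[R]_d) :
  gkernel eps x x = 1.
Proof.
rewrite /gkernel /sqdist big1 ?mul0r ?oppr0 ?expR0// => l _.
by rewrite subrr expr0n.
Qed.

Lemma gkernelC (R : realType) (d : nat) (eps : R) (x y : 'rV[R]_d) :
  gkernel eps x y = gkernel eps y x.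
Proof. by rewrite /gkernel sqdistC. Qed.

Lemma gkernel_le1 (R : realType) (d : nat) (eps : R) (x y : 'rV[R]_d) :
  gkernel eps x y <= 1.
Proof.
rewrite /gkernel -[leRHS]expR0 ler_expR oppr_le0 divr_ge0 ?sqr_ge0//.
by apply: sumr_ge0 => l _; exact: sqr_ge0.
Qed.

Lemma gkernel_ge_prod (R : realType) (d : nat) (eps : R) (x y z : 'rV[R]_d) :
  gkernel eps z x ^+ 2 * gkernel eps z y ^+ 2 <= gkernel eps x y.
Proof.
rewrite /gkernel -!expRM_natl -expRD ler_expR -subr_ge0.
rewrite (_ : _ - _ = (2 * sqdist z x + 2 * sqdist z y - sqdist x y) / eps ^+ 2);
  last by ring.
by rewrite divr_ge0 ?sqr_ge0// subr_ge0 sqdist_le.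
Qed.

(** * Kernel sums over pairs of finite sets *)

(** Diagonal terms are kept, unlike in [objective], so that positive semidefiniteness applies
    directly. *)
Definition ksum {R : realType} {d : nat} (eps : R) (A B : {fset 'rV[R]_d}) : R :=
  \sum_(x <- A) \sum_(y <- B) gkernel eps x y.

Lemma sum_fset_const (R : realType) (T : choiceType) (A : {fset T}) (a : R) :
  \sum_(x <- A) a = a * #|` A|%:R.
Proof. by rewrite big_const_seq count_predT iter_addr_0 mulr_natr. Qed.

Lemma ksumC (R : realType) (d : nat) (eps : R) (A B : {fset 'rV[R]_d}) :
  ksum eps A B = ksum eps B A.
Proof.
rewrite /ksum exchange_big; apply: eq_bigr => x _; apply: eq_bigr => y _.
exact: gkernelC.
Qed.

Lemma ksumID (R : realType) (d : nat) (eps : R) (A B S : {fset 'rV[R]_d}) :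
  ksum eps A S = ksum eps (A `&` B) S + ksum eps (A `\` B) S.
Proof.
rewrite /ksum (big_fsetID _ (mem B))/=.
by congr (_ + _); apply: eq_fbigl => x; rewrite !inE// andbC.
Qed.

Lemma ksum_ge0 (R : realType) (d : nat) (eps : R) (A B : {fset 'rV[R]_d}) :
  0 <= ksum eps A B.
Proof. by do 2 apply: sumr_ge0 => ? _; exact: gkernel_ge0. Qed.

Lemma ksum_ge_card (R : realType) (d : nat) (eps : R) (A : {fset 'rV[R]_d}) :
  #|` A|%:R <= ksum eps A A.
Proof.
rewrite -[leLHS]mul1r -sum_fset_const /ksum [leLHS]big_seq [leRHS]big_seq.
apply: ler_sum => x xA.
rewrite (big_fsetD1 x)//= gkernelxx lerDl.
by apply: sumr_ge0 => y _; exact: gkernel_ge0.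
Qed.

(** This is the quadratic form with coefficient -1 on [A] and +1 on [B]; the boolean tag separates
    the two copies of a common point. *)
Lemma ksum_psd (R : realType) (d : nat) (eps : R) (A B : {fset 'rV[R]_d}) :
  2 * ksum eps A B <= ksum eps A A + ksum eps B B.
Proof.
pose s := [seq (true, x) | x <- A] ++ [seq (false, x) | x <- B].
have := @psd_gkernel R d _ (@snd bool 'rV[R]_d) eps s (fun i => (-1) ^+ i.1).
rewrite /s big_cat !big_map/=.
under eq_bigr do rewrite big_cat !big_map/=.
under [X in _ + X]eq_bigr do rewrite big_cat !big_map/=.
rewrite !big_split/=.
under eq_bigr do under eq_bigr do rewrite expr1 mulrNN !mul1r.
under [X in (_ + X) + _]eq_bigr do
  under eq_bigr do rewrite expr1 expr0 mulr1 mulN1r.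
under [X in _ + (X + _)]eq_bigr do
  under eq_bigr do rewrite expr1 expr0 mul1r mulN1r.
under [X in _ + (_ + X)]eq_bigr do
  under eq_bigr do rewrite expr0 !mul1r.
under [X in (_ + X) + _]eq_bigr do rewrite sumrN.
under [X in _ + (X + _)]eq_bigr do rewrite sumrN.
rewrite !sumrN -!/(ksum _ _ _) (ksumC _ _ _ B A).
by lra.
Qed.

Lemma objectiveE (R : realType) (d : nat) (eps : R) (A : {fset 'rV[R]_d}) :
  objective eps A = (ksum eps A A - #|` A|%:R) / 2.
Proof.
rewrite /objective; congr (_ / _).
rewrite -[X in _ - X]mul1r -sum_fset_const -sumrB !big_seq.
apply: eq_bigr => x xA; rewrite (big_fsetD1 x)//= gkernelxx addrAC subrr add0r.
rewrite big_fset_condE; apply: eq_fbigl => y; rewrite !inE/= eq_sym.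
exact: andbC.
Qed.

(** * Inequalities from exchange stability *)

Lemma objective_fsetU1 (R : realType) (d : nat) (eps : R) (t : 'rV[R]_d)
    (A : {fset 'rV[R]_d}) : t \notin A ->
  objective eps (t |` A) = objective eps A + \sum_(x <- A) gkernel eps t x.
Proof.
move=> tA; rewrite !objectiveE cardfsU1 tA natrD /ksum big_fsetU1//=.
rewrite big_fsetU1//= gkernelxx.
under [X in _ + X - _]eq_bigr do rewrite big_fsetU1//= gkernelC.
by rewrite big_split/=; lra.
Qed.

(** Both sets extend [A] minus [s] by one point, so the common objective cancels. Restoring [s] to
    the two sums adds 1 on the left and [gkernel eps t s] on the right; the sums over all of [A] can
    then be added up over [s]. *)
Lemma exchange_ineq (R : realType) (d : nat) (eps : R) (s t : 'rV[R]_d)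
    (A : {fset 'rV[R]_d}) : s \in A -> t \notin A ->
  objective eps A <= objective eps ((A `\ s) `|` [fset t]) ->
  \sum_(x <- A) gkernel eps s x + gkernel eps s t
    <= 1 + \sum_(x <- A) gkernel eps t x.
Proof.
move=> sA tA; rewrite -[X in objective _ X <= _](fsetD1K sA) (fsetUC _ [fset t]).
rewrite !objective_fsetU1 ?inE ?eqxx ?(negbTE tA) ?andbF// lerD2l => h.
rewrite !(big_fsetD1 s sA)/= gkernelxx (gkernelC _ _ _ t s).
by lra.
Qed.

Lemma exchange_sum_ineq (R : realType) (d : nat) (eps : R)
    (A S T : {fset 'rV[R]_d}) : S `<=` A -> [disjoint T & A]%fset ->
  (forall s t, s \in S -> t \in T ->
     objective eps A <= objective eps ((A `\ s) `|` [fset t])) ->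
  #|` T|%:R * ksum eps S A + ksum eps S T
    <= #|` S|%:R * #|` T|%:R + #|` S|%:R * ksum eps T A.
Proof.
move=> /fsubsetP SA /fdisjointP TA opt.
have : \sum_(s <- S) \sum_(t <- T)
     (\sum_(x <- A) gkernel eps s x + gkernel eps s t)
   <= \sum_(s <- S) \sum_(t <- T) (1 + \sum_(x <- A) gkernel eps t x).
  rewrite [leLHS]big_seq [leRHS]big_seq; apply: ler_sum => s sS.
  rewrite [leLHS]big_seq [leRHS]big_seq; apply: ler_sum => t tT.
  by apply: exchange_ineq; [exact: SA | exact: TA | exact: opt].
under eq_bigr do rewrite big_split/= sum_fset_const.
rewrite big_split/= -mulr_suml -!/(ksum _ _ _).
under [leRHS]eq_bigr do rewrite big_split/= sum_fset_const mul1r.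
by rewrite sum_fset_const -!/(ksum _ _ _); lra.
Qed.

(** * Samples of two points *)

Lemma cardfs2_ex (T : choiceType) (A : {fset T}) :
  #|` A| = 2%N -> exists a b, a != b /\ A = [fset a; b].
Proof.
move=> A2; have /fset0Pn[a aA] : A != fset0 by rewrite -cardfs_gt0 A2.
have := cardfsD1 a A; rewrite aA A2 => -[/esym/eqP/cardfs1P[b Ab]].
exists a, b; split; last by rewrite -Ab fsetD1K.
by have : b \in A `\ a by [rewrite Ab inE]; rewrite !inE eq_sym => /andP[].
Qed.

Lemma objective2 (R : realType) (d : nat) (eps : R) (a b : 'rV[R]_d) :
  a != b -> objective eps [fset a; b] = gkernel eps a b.
Proof.
move=> ab; rewrite objective_fsetU1 ?inE// big_seq_fset1 objectiveE /ksum.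
by rewrite !big_seq_fset1 gkernelxx cardfs1 subrr mul0r add0r.
Qed.

(* An exchange-stable pair {a, b} has gkernel b a <= gkernel b t for all t in D,
   so with alpha the kernel on {a, b}, the kernel on the other pair is at least
   alpha ^+ 4; and alpha - alpha ^+ 4 <= 1 / 2. *)
Lemma exchange_gap2 (R : realType) (d : nat) (eps : R)
    (A B : {fset 'rV[R]_d}) :
  #|` A| = 2%N -> #|` B| = 2%N ->
  (forall s t, s \in A -> t \in B -> t \notin A ->
     objective eps A <= objective eps ((A `\ s) `|` [fset t])) ->
  objective eps A - objective eps B <= 1 / 2.
Proof.
move=> /cardfs2_ex[a [b [ab ->]]] /cardfs2_ex[x [y [xy ->]]] opt.
have ge t : t \in [fset x; y] -> gkernel eps b a <= gkernel eps b t.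
  move=> tB; have [->|tb] := eqVneq t b; first by rewrite gkernelxx gkernel_le1.
  have [->//|ta] := eqVneq t a.
  have tA : t \notin [fset a; b] by rewrite !inE negb_or ta.
  have := exchange_ineq _ _ _ _ _ _ _ tA (opt a t _ tB tA).
  rewrite !inE eqxx => /(_ isT isT).
  rewrite !big_fsetU1 ?inE//= !big_seq_fset1 gkernelxx.
  rewrite (gkernelC _ _ _ a b) (gkernelC _ _ _ a t) (gkernelC _ _ _ t b).
  lra.
rewrite !objective2// (gkernelC _ _ _ a b).
have := ge x; have := ge y; rewrite !inE !eqxx orbT => /(_ isT) gy /(_ isT) gx.
have := gkernel_ge_prod _ _ eps x y b.
have := gkernel_ge0 _ _ eps b a.
move: gx gy; set al := gkernel eps b a => gx gy al0 prod.
have : al ^+ 2 * al ^+ 2 <= gkernel eps b x ^+ 2 * gkernel eps b y ^+ 2.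
  by apply: ler_pM; rewrite ?sqr_ge0// lerXn2r// nnegrE (le_trans al0).
(* The two squares add up to [al ^+ 4 - al + 1 / 2]. *)
have := sqr_ge0 (al ^+ 2 - 1 / 2); have := sqr_ge0 (al - 1 / 2).
nra.
Qed.

(** * The gap between objectives for general [K] *)

Lemma ksumIDr (R : realType) (d : nat) (eps : R) (A B S : {fset 'rV[R]_d}) :
  ksum eps S A = ksum eps S (A `&` B) + ksum eps S (A `\` B).
Proof. by rewrite 3!(ksumC _ _ _ S) (ksumID _ _ _ A B). Qed.

Lemma ksum_setID (R : realType) (d : nat) (eps : R) (A B : {fset 'rV[R]_d}) :
  ksum eps A A = ksum eps (A `\` B) (A `\` B)
    + 2 * ksum eps (A `\` B) (A `&` B) + ksum eps (A `&` B) (A `&` B).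
Proof.
rewrite (ksumID _ _ _ A B) !(ksumIDr _ _ _ A B).
by rewrite (ksumC _ _ _ (A `&` B) (A `\` B)); ring.
Qed.

Lemma exchange_gap (R : realType) (d : nat) (eps : R)
    (K : nat) (A B : {fset 'rV[R]_d}) :
  (2 <= K)%N -> #|` A| = K -> #|` B| = K ->
  (forall s t, s \in A -> t \in B -> t \notin A ->
     objective eps A <= objective eps ((A `\ s) `|` [fset t])) ->
  objective eps A - objective eps B <= K%:R * (K%:R - 1) / 4.
Proof.
move=> K2 cA cB opt.
have [eK|K3] : K = 2%N \/ (3 <= K)%N by lia.
  rewrite eK (le_trans (exchange_gap2 _ _ _ _ _ _ _ opt)) ?cA ?cB//; lra.
have [/cardfs0_eq/eqP|m0] := posnP #|` A `\` B|.
  rewrite fsetD_eq0 => AB; have -> : A = B by apply/eqP; rewrite eqEfcard AB cA cB /=.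
  have : 1 <= K%:R :> R by rewrite ler1n; lia.
  by rewrite subrr => K1; rewrite divr_ge0 ?mulr_ge0 ?subr_ge0.
have cAB : #|` A `\` B| = #|` B `\` A| by rewrite !cardfsD fsetIC cA cB.
have mK : (#|` A `\` B| <= K)%N by rewrite -cA fsubset_leq_card// fsubsetDl.
have := @exchange_sum_ineq _ _ eps A (A `\` B) (B `\` A).
rewrite fsubsetDl -cAB => /(_ isT) L.
have {L} L : #|` A `\` B|%:R * ksum eps (A `\` B) A
    + ksum eps (A `\` B) (B `\` A)
  <= #|` A `\` B|%:R * #|` A `\` B|%:R
    + #|` A `\` B|%:R * ksum eps (B `\` A) A.
  apply: L => [|s t]; first by apply/fdisjointP => x; rewrite inE => /andP[].
  by rewrite !inE => /andP[_ sA] /andP[tA tB]; exact: opt.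
have p_m := ksum_ge_card _ _ eps (A `\` B).
have q_m := ksum_ge_card _ _ eps (B `\` A).
have pq := ksum_psd _ _ eps (A `\` B) (B `\` A).
have X0 := ksum_ge0 _ _ eps (A `\` B) (B `\` A).
have IC : B `&` A = A `&` B by rewrite fsetIC.
have empty : #|` A `\` B| = K ->
    ksum eps (A `\` B) (A `&` B) = 0 /\ ksum eps (B `\` A) (A `&` B) = 0.
  move=> mE; have /cardfs0_eq -> : #|` A `&` B| = 0%N.
    by have := cardfsID B A; lia.
  by rewrite 2!(ksumC _ _ _ _ fset0) /ksum !big_seq_fset0.
rewrite !objectiveE cA cB.
move: L p_m q_m pq X0 empty.
rewrite (ksum_setID _ _ _ A B) (ksum_setID _ _ _ B A) IC !(ksumIDr _ _ _ A B).
rewrite (ksumC _ _ _ (B `\` A) (A `\` B)).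
rewrite -cAB.
set u := ksum eps (A `\` B) (A `&` B); set v := ksum eps (B `\` A) (A `&` B).
set p := ksum _ (A `\` B) _; set q := ksum _ (B `\` A) _.
set X := ksum _ _ (B `\` A); set m := #|` _| in m0 mK *.
move=> L p_m q_m pq X0 empty.
(* For [m = K = 3] the bound [2 * (m - 1) = 4] exceeds the required 3. There [L] and [pq] give
   [2 * p - q <= 9], and [3 <= q] yields [p - q <= 3]. *)
have [mK3|mK4] : (m = K /\ K = 3)%N \/ (m < K \/ 4 <= K)%N by lia.
  have [mE KE] := mK3; have [u0 v0] := empty mE.
  by move: L p_m q_m; rewrite mE KE u0 v0; lra.
have m1 : 1 <= m%:R :> R by rewrite ler1n.
(* After multiplying by [m] and using [L] twice, it remains to see
   [2 * (m - 1) * X + 2 * m <= m * (p + q)]. If [m <= X], this follows from [pq]; otherwise from [p]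
   and [q] being at least [m]. *)
have E : p + 2 * u - q - 2 * v <= 2 * (m%:R - 1).
  have m0' : 0 < m%:R :> R by lra.
  rewrite -(ler_pM2l m0').
  have [mX|Xm] := lerP m%:R X.
    have := ler_wpM2l (ltW m0') pq; lra.
  have := ler_wpM2l (ltW m0') (lerD p_m q_m).
  have m1' : 0 <= m%:R - 1 :> R by lra.
  have := ler_wpM2l m1' (ltW Xm); lra.
have mKR : 4 * (m%:R - 1) <= K%:R * (K%:R - 1) :> R.
  (* If [m < K], this reduces to [K ^ 2 - 5 * K + 8 >= 0], whose discriminant is negative; if
     [4 <= K], then [m <= K] suffices. *)
  have : (4 * (m - 1) <= K * (K - 1))%N by case: mK4; nia.
  by rewrite -(ler_nat R) !natrM !natrB//; lia.
lra.
Qed.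
Local Open Scope fset_scope.

Theorem theorem3 (R : realType) (d : nat) (D : {fset 'rV[R]_d}) (eps : R)
    (K : nat) (S_opt S_int : {fset 'rV[R]_d}) :
  0 < eps ->
  (2 <= K)%N -> (K <= #|` D|)%N ->
  S_opt `<=` D -> #|` S_opt| = K ->
  (forall S : {fset 'rV[R]_d}, S `<=` D -> #|` S| = K ->
     objective eps S_opt <= objective eps S) ->
  S_int `<=` D -> #|` S_int| = K ->
  (forall s t : 'rV[R]_d, s \in S_int -> t \in D -> t \notin S_int ->
     objective eps S_int <= objective eps ((S_int `\ s) `|` [fset t])) ->
  (objective eps S_int / (K * (K - 1))%:R
    <= 1 / 4 + objective eps S_opt / (K * (K - 1))%:R)%R.
Proof.
move=> _ K2 _ optD cardO _ _ cardI opt.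
have N0 : 0 < (K * (K - 1))%:R :> R by rewrite ltr0n muln_gt0 subn_gt0 K2 (ltnW K2).
(* Clearing the denominator leaves the gap bound [K * (K - 1) / 4]. *)
rewrite -lerBlDr -mulrBl ler_pdivrMr// mul1r [leRHS]mulrC.
rewrite natrM natrB ?(ltnW K2)//.
apply: exchange_gap => // s t sI tO; apply: opt => //.
exact: (fsubsetP optD).
Qed.
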